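(* Let $n\ge 2$, let $\vec a=(1,1,\dots,1)$ be the all-ones vector of length $n$, let $1\le d\le n-1$, and put $m=n-d$. Let $\mathsf M=\mathsf M(\vec a;d)$ be the extremal matrix of the polytope $\operatorname{RA}(\vec a;0,d)$. Then for indices $1\le i,j\le n$, writing $t=i-d$, $$\mathsf M[i][j]=0\iff 1\le t\le m,\quad 1\le j\le m,\quad t\ne j.$$ Inside the $m\times m$ block $1\le t\le m$, $1\le j\le m$ only the diagonal survives, so that this block is the identity matrix $I_m$; outside it every entry is $1$. Consequently $\operatorname{RA}(\vec a;0,d)$ has exactly $n^2-m(m-1)$ vertices.
   Context: For a vector $\vec a=(a_1,\dots,a_n)$ of positive integers, let $v_j=(a_1,\dots,a_j,0,\dots,0)\in\mathbb R^n$ for $1\le j\le n$, and let $\angle(\vec a)=\operatorname{conv}\{v_1,\dots,v_n\}$ (the right-angle simplex). Put $N=n+d$. Regard $\mathbb R^n\subseteq\mathbb R^N$ by padding with zeros on the right, and let $\operatorname{shift}^d:\mathbb R^n\to\mathbb R^N$ prepend $d$ zeros. Write $u_j=\operatorname{shift}^d(v_j)$. The right-angle polytope is the Minkowski sum $\operatorname{RA}(\vec a;0,d)=\angle(\vec a)+\operatorname{shift}^d(\angle(\vec a))\subseteq\mathbb R^N$. The extremal matrix $\mathsf M(\vec a;d)$ is the $n\times n$ matrix with entries in $\{0,1\}$, indices running from $1$ to $n$, defined by $\mathsf M(\vec a;d)[i][j]=1$ if and only if $v_i+u_j$ is a vertex (extreme point) of $\operatorname{RA}(\vec a;0,d)$;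 the row index $i$ belongs to the unshifted summand and the column index $j$ to the shifted one. *)

(* Defs.v *)
From HB Require Import structures.
From mathcomp Require Import all_boot all_order all_algebra.
From mathcomp Require Import boolp classical_sets cardinality reals.

Set Implicit Arguments.
Unset Strict Implicit.
Unset Printing Implicit Defensive.

Import Order.TTheory GRing.Theory Num.Theory.

Local Open Scope classical_set_scope.
Local Open Scope ring_scope.

(* Indices 1, ..., n are encoded by 'I_n: i : 'I_n stands for index i.+1. *)

Section RightAnglePolytope.
Variable R : realType.

Definition conv_hull k N (v : 'I_k -> 'rV[R]_N) : set 'rV[R]_N :=
  [set x | exists w : 'I_k -> R,
     [/\ forall i, 0 <= w i, \sum_i w i = 1 & x = \sum_i w i *: v i]].

Definition extreme_point N (A : set 'rV[R]_N) (x : 'rV[R]_N) : Prop :=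
  A x /\ forall (y z : 'rV[R]_N) (l : R), A y -> A z -> 0 < l < 1 ->
    x = l *: y + (1 - l) *: z -> y = x /\ z = x.

Definition minkowski_sum N (A B : set 'rV[R]_N) : set 'rV[R]_N :=
  [set x + y | x in A & y in B].

Definition pad n (d : nat) (x : 'rV[R]_n) : 'rV[R]_(n + d) := row_mx x 0.

Definition shift n (d : nat) (x : 'rV[R]_n) : 'rV[R]_(n + d) :=
  castmx (erefl, addnC d n) (row_mx (0 : 'rV[R]_d) x).

Arguments pad [n] d x.
Arguments shift [n] d x.

Definition angle_vertex n (a : 'rV[nat]_n) (j : 'I_n) : 'rV[R]_n :=
  \row_(k < n) (if (k <= j)%N then (a 0 k)%:R else 0).

Definition angle n (a : 'rV[nat]_n) : set 'rV[R]_n :=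
  conv_hull (angle_vertex a).

Definition RA n (a : 'rV[nat]_n) (d : nat) : set 'rV[R]_(n + d) :=
  minkowski_sum (pad d @` angle a) (shift d @` angle a).

Arguments RA [n] a d _.

Definition extremal_matrix n (a : 'rV[nat]_n) (d : nat) : 'M[nat]_n :=
  \matrix_(i < n, j < n)
    nat_of_bool `[< extreme_point (RA a d)
        (pad d (angle_vertex a i) + shift d (angle_vertex a j)) >].

End RightAnglePolytope.

Arguments RA R [n] a d _.
Arguments extremal_matrix R [n] a d.

Lemma block_row_subproof n d (t : 'I_(n - d)) : (d + t < n)%N.
Proof. by rewrite -ltn_subRL. Qed.

(* The 1-based row index i = d + t with 1 <= t <= n - d. *)
Definition block_row n d (t : 'I_(n - d)) : 'I_n :=
  Ordinal (block_row_subproof t).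

Definition block_col n d : 'I_(n - d) -> 'I_n := widen_ord (leq_subr d n).

(* Main.v *)
(** With 0-based indices, [v i] and [u j] are the indicators of the integer
    intervals [[0, i]] and [[d, d + j]].  Every extreme point of the sum is some
    [v i + u j], and an extreme point has a unique such decomposition.  If
    [d <= i], [d + j < n] and [i <> d + j], exchanging right endpoints gives
    [v i + u j = v (d + j) + u (i - d)], so this point is not extreme.  In all
    other cases a linear functional is maximised over the [v]'s only at [v i]
    and over the [u]'s only at [u j]: on interval indicators a functional is a
    difference of values of an arbitrary potential [D] at the endpoints, and it
    suffices to put the two largest values of [D] at the right endpoints of
    [v i] and [u j], the larger one at an endpoint that the other family does
    not reach (or a single peak if the endpoints coincide). *)

From HB Require Import structures.
Require Import Defs.
From mathcomp Require Import all_boot all_order all_algebra.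
From mathcomp Require Import boolp classical_sets cardinality reals.
From mathcomp Require Import zify lra ring.

Set Implicit Arguments.
Unset Strict Implicit.
Unset Printing Implicit Defensive.

Import Order.TTheory GRing.Theory Num.Theory.
Local Open Scope classical_set_scope.
Local Open Scope card_scope.
Local Open Scope ring_scope.

(** * Extreme points of hulls and of Minkowski sums *)

Section ConvexHulls.
Variable R : realType.

Lemma conv_hull_mem k N (v : 'I_k -> 'rV[R]_N) (i : 'I_k) : conv_hull v (v i).
Proof.
exists (fun l => (l == i)%:R); split=> [l||]; first exact: ler0n.
- by rewrite (bigD1 i) //= eqxx big1 ?addr0 // => l /negPf->.
- rewrite (bigD1 i) //= eqxx scale1r big1 ?addr0 // => l /negPf->.
  by rewrite scale0r.
Qed.

Lemma image_conv_hull k N N' (f : 'rV[R]_N -> 'rV[R]_N') (v : 'I_k -> 'rV[R]_N) :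
  linear f -> f @` conv_hull v = conv_hull (f \o v).
Proof.
move=> lin_f.
pose g : {linear 'rV[R]_N -> 'rV[R]_N'} :=
  HB.pack f (GRing.isLinear.Build _ _ _ _ f lin_f).
have fE (w : 'I_k -> R) : f (\sum_i w i *: v i) = \sum_i w i *: f (v i).
  transitivity (g (\sum_i w i *: v i)) => //.
  by rewrite linear_sum; apply: eq_bigr => i _; rewrite linearZ.
apply/seteqP; split=> [_ [_ [w [w0 w1 ->]] <-]|_ [w [w0 w1 ->]]].
  by exists w; split=> //; rewrite fE.
by exists (\sum_i w i *: v i); [exists w | rewrite fE].
Qed.

(** Some generator has positive weight. If that weight is below 1, [x] lies strictly between this
    generator and the renormalised combination of the others, so extremality makes both equal to
    [x]. *)
Lemma extreme_point_conv_hull k N (v : 'I_k -> 'rV[R]_N) x :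
  extreme_point (conv_hull v) x -> exists i, v i = x.
Proof.
move=> [[w [w0 w1 xE]] ext_x].
have [i wi0] : exists i, w i != 0.
  apply: contrapT => /forallNP w_eq0; move: w1; rewrite big1 => [|i _].
    by move/eqP; rewrite eq_sym oner_eq0.
  by apply/eqP/negP => /negP/w_eq0.
exists i.
have wi_gt0 : 0 < w i by rewrite lt_def wi0 w0.
have sumE : w i + \sum_(l | l != i) w l = 1 by rewrite -w1 [RHS](bigD1 i).
have sum_ge0 : 0 <= \sum_(l | l != i) w l by apply: sumr_ge0.
have [wi1|wi_neq1] := eqVneq (w i) 1.
  have w_eq0 l : l != i -> w l = 0.
    apply: (psumr_eq0P (P := fun l => l != i)) => [l' _|]; first exact: w0.
    by lra.
  rewrite xE (bigD1 i) //= wi1 scale1r big1 ?addr0 // => l /w_eq0->.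
  by rewrite scale0r.
have wi_lt1 : w i < 1 by rewrite lt_def eq_sym wi_neq1; lra.
have w'0 : 1 - w i != 0 by rewrite subr_eq0 eq_sym.
pose w' l := if l == i then 0 else (1 - w i)^-1 * w l.
have sumw' : \sum_l w' l = 1.
  rewrite (bigD1 i) //= {1}/w' eqxx add0r.
  rewrite (eq_bigr (fun l => (1 - w i)^-1 * w l)) => [|l /negPf li].
    by rewrite -mulr_sumr (_ : \sum_(l | _) _ = 1 - w i) ?mulVf //; lra.
  by rewrite /w' li.
have := ext_x (v i) (\sum_l w' l *: v l) (w i) (conv_hull_mem v i).
case=> //; first 2 [by rewrite wi_gt0].
- exists w'; split=> // l; rewrite /w'; case: ifP => // _.
  by rewrite mulr_ge0 // invr_ge0; lra.
- rewrite xE (bigD1 i) //=; congr (_ + _).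
  rewrite [in RHS](bigD1 i) //= {1}/w' eqxx scale0r add0r scaler_sumr.
  by apply: eq_bigr => l /negPf li; rewrite scalerA /w' li mulVKf.
Qed.

(** A segment in one summand, translated by the fixed point of the other, stays in the sum. *)
Lemma extreme_point_minkowski_sum N (A B : set 'rV[R]_N) y z :
  A y -> B z -> extreme_point (minkowski_sum A B) (y + z) ->
  extreme_point A y /\ extreme_point B z.
Proof.
move=> Ay Bz [_ ext]; split; split=> // p q l Ap Aq l01 E.
- have [||//|] := ext (p + z) (q + z) l _ _ l01.
  + by exists p => //; exists z.
  + by exists q => //; exists z.
  + by rewrite E !scalerDr addrACA -[in RHS]scalerDl subrKC scale1r.
  + by move=> /addIr-> /addIr->.
- have [||//|] := ext (y + p) (y + q) l _ _ l01.
  + by exists y => //; exists p.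
  + by exists y => //; exists q.
  + by rewrite E !scalerDr addrACA -[in RHS]scalerDl subrKC scale1r.
  + by move=> /addrI-> /addrI->.
Qed.

(** The gap to the maximum is a sum of non-negative terms [w l * (L (v i) - L (v l))]; if it
    vanishes, so does every weight off [i]. *)
Lemma conv_hull_unique_max k N (L : {scalar 'rV[R]_N}) (v : 'I_k -> 'rV[R]_N) i :
  (forall l, l != i -> L (v l) < L (v i)) ->
  forall y, conv_hull v y -> L y <= L (v i) /\ (L y = L (v i) -> y = v i).
Proof.
move=> max_i _ [w [w0 w1 ->]].
have gapE : L (v i) - L (\sum_l w l *: v l) = \sum_l w l * (L (v i) - L (v l)).
  rewrite linear_sum -[L (v i) in LHS]mul1r -w1 mulr_suml -sumrB.
  by apply: eq_bigr => l _; rewrite linearZ mulrBr.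
have gap_ge0 l : 0 <= w l * (L (v i) - L (v l)).
  have [->|/max_i lt_li] := eqVneq l i; first by rewrite subrr mulr0.
  by rewrite mulr_ge0 // subr_ge0 ltW.
split=> [|eqL]; first by rewrite -subr_ge0 gapE sumr_ge0.
have w_eq0 l : l != i -> w l = 0.
  move=> li; have lt_li := max_i l li.
  have /eqP : w l * (L (v i) - L (v l)) = 0.
    move: gapE; rewrite eqL subrr => /esym sum0.
    exact: (psumr_eq0P (fun l' _ => gap_ge0 l') sum0).
  by rewrite mulf_eq0 subr_eq0 (gt_eqF lt_li) orbF => /eqP.
have wi1 : w i = 1 by rewrite -w1 (bigD1 i) //= big1 ?addr0.
rewrite (bigD1 i) //= wi1 scale1r big1 ?addr0 // => l /w_eq0->.
by rewrite scale0r.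
Qed.

Lemma convex_comb_eq_max (a b s l : R) :
  a <= s -> b <= s -> 0 < l < 1 -> s = l * a + (1 - l) * b -> a = s /\ b = s.
Proof.
move=> las lbs /andP[l0 l1] E.
have /eqP : l * (s - a) + (1 - l) * (s - b) = 0 by ring: E.
have l1' : 0 < 1 - l by rewrite subr_gt0.
rewrite paddr_eq0; [|by rewrite mulr_ge0 ?subr_ge0 // ltW..].
by rewrite !mulf_eq0 (gt_eqF l0) (gt_eqF l1') !subr_eq0 => /andP[/eqP-> /eqP->].
Qed.

(** A maximum over the sum is attained only where both summands attain theirs, so [L] exposes
    [p i + q j]. *)
Lemma exposed_extreme_point k N (L : {scalar 'rV[R]_N})
    (p q : 'I_k -> 'rV[R]_N) i j :
  (forall l, l != i -> L (p l) < L (p i)) ->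
  (forall l, l != j -> L (q l) < L (q j)) ->
  extreme_point (minkowski_sum (conv_hull p) (conv_hull q)) (p i + q j).
Proof.
move=> max_i max_j.
have maxS y : minkowski_sum (conv_hull p) (conv_hull q) y ->
    L y <= L (p i + q j) /\ (L y = L (p i + q j) -> y = p i + q j).
  move=> [a /(conv_hull_unique_max max_i)[lea eqa]].
  move=> [b /(conv_hull_unique_max max_j)[leb eqb] <-].
  rewrite !linearD; split=> [|E]; first exact: lerD.
  have La : L a = L (p i).
    by apply/le_anti; rewrite lea -(lerD2r (L b)) E lerD2l leb.
  by move: E; rewrite La => /addrI/eqb->; rewrite (eqa La).
split; first by exists (p i); [|exists (q j)]; rewrite //; exact: conv_hull_mem.
move=> y z l /maxS[ley eqy] /maxS[lez eqz] l01 E.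
have LE : L (p i + q j) = l * L y + (1 - l) * L z.
  by rewrite {1}E linearD !linearZ.
by have [/eqy-> /eqz->] := convex_comb_eq_max ley lez l01 LE.
Qed.

End ConvexHulls.

(** * Interval indicators and potentials *)

Section IntervalVectors.
Variable R : realType.

Definition interval_row N (lo hi : nat) : 'rV[R]_N :=
  \row_(k < N) (lo <= k < hi)%N%:R.

(* By telescoping, any prescribed potential [D] is realised as a linear
   functional with value [D hi - D lo] on the indicator of [lo, hi). *)
Definition potential N (D : nat -> R) (x : 'rV[R]_N) : R :=
  \sum_(k < N) (D k.+1 - D k) * x 0 k.

Fact potential_is_scalar N D : scalar (@potential N D).
Proof.
move=> c x y; rewrite /potential mulr_sumr -big_split; apply: eq_bigr => k _ /=.
by rewrite !mxE; ring.
Qed.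

HB.instance Definition _ N D :=
  GRing.isLinear.Build R 'rV[R]_N R *%R (@potential N D) (@potential_is_scalar N D).

Lemma potential_interval_row N D lo hi : (lo <= hi <= N)%N ->
  potential D (interval_row N lo hi) = D hi - D lo.
Proof.
move=> /andP[lohi hiN].
rewrite -[RHS](telescope_sumr D lohi) /potential big_geq_mkord /=.
rewrite (big_ord_widen_cond N (fun k => lo <= k)%N (fun k => D k.+1 - D k)) //.
rewrite [RHS]big_mkcond; apply: eq_bigr => k _ /=.
by rewrite mxE; case: ifP; rewrite ?mulr1 ?mulr0.
Qed.

Lemma pad_angle_vertex n d (i : 'I_n) :
  pad d (angle_vertex R (const_mx 1%N) i) = interval_row (n + d) 0 i.+1.
Proof.
apply/rowP => k; rewrite /pad !mxE; case: splitP => l kl; rewrite !mxE kl.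
  by rewrite ltnS; case: leq.
by rewrite (_ : (n + l < i.+1)%N = false) //; have := ltn_ord i; lia.
Qed.

Lemma shift_angle_vertex n d (j : 'I_n) :
  shift d (angle_vertex R (const_mx 1%N) j) =
  interval_row (n + d) d (d + j.+1).
Proof.
apply/rowP => k; rewrite /shift castmxE !mxE; case: splitP => l /= kl;
  rewrite !mxE kl.
  by rewrite leqNgt ltn_ord.
by rewrite leq_addr ltn_add2l ltnS; case: leq.
Qed.

Lemma interval_row_inj N lo hi hi' : (lo <= hi <= N)%N -> (lo <= hi' <= N)%N ->
  interval_row N lo hi = interval_row N lo hi' -> hi = hi'.
Proof.
(* The identity potential measures the length [hi - lo]. *)
move=> hiN hi'N /(congr1 (potential (fun k => k%:R))).
by rewrite !potential_interval_row // => /addIr/eqP; rewrite eqr_nat => /eqP.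
Qed.

End IntervalVectors.

(** * Vertices of the all-ones polytope *)

Section AllOnes.
Variables (R : realType) (n d : nat).

Definition v_ (i : 'I_n) : 'rV[R]_(n + d) := interval_row R (n + d) 0 i.+1.
Definition u_ (j : 'I_n) : 'rV[R]_(n + d) := interval_row R (n + d) d (d + j.+1).

Lemma v_bound (i : 'I_n) : (0 <= i.+1 <= n + d)%N.
Proof. by have := ltn_ord i; lia. Qed.

Lemma u_bound (j : 'I_n) : (d <= d + j.+1 <= n + d)%N.
Proof. by have := ltn_ord j; lia. Qed.

Lemma v_inj : injective v_.
Proof.
move=> i i' /(interval_row_inj (v_bound i) (v_bound i')) [ii'].
exact: val_inj.
Qed.

Lemma u_inj : injective u_.
Proof.
move=> j j' /(interval_row_inj (u_bound j) (u_bound j')) jj'.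
by apply: val_inj => /=; lia.
Qed.

Lemma RA_onesE :
  RA R (const_mx 1%N : 'rV[nat]_n) d = minkowski_sum (conv_hull v_) (conv_hull u_).
Proof.
have lin_pad : linear (@pad R n d).
  move=> c x y; apply/rowP => k; rewrite !mxE.
  by case: splitP => l _; rewrite !mxE ?mulr0 ?addr0.
have lin_shift : linear (@shift R n d).
  move=> c x y; apply/rowP => k; rewrite !(castmxE, mxE).
  by case: splitP => l _; rewrite !mxE ?mulr0 ?addr0.
have padE : pad d \o angle_vertex R (const_mx 1%N) = v_.
  by apply: funext => i; exact: pad_angle_vertex.
have shiftE : shift d \o angle_vertex R (const_mx 1%N) = u_.
  by apply: funext => j; exact: shift_angle_vertex.
rewrite /RA /angle (image_conv_hull _ lin_pad) (image_conv_hull _ lin_shift).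
by rewrite padE shiftE.
Qed.

Local Notation P := (minkowski_sum (conv_hull v_) (conv_hull u_)).

Lemma vuP i j : P (v_ i + u_ j).
Proof.
by exists (v_ i); [|exists (u_ j)]; rewrite //; exact: conv_hull_mem.
Qed.

(** When the two sums agree, their common value is the midpoint of the mixed sums [v_ i + u_ j'] and
    [v_ i' + u_ j]; extremality identifies these with it, and cancellation finishes. *)
Lemma extreme_point_vu_inj i j i' j' :
  extreme_point P (v_ i + u_ j) -> v_ i + u_ j = v_ i' + u_ j' -> i = i' /\ j = j'.
Proof.
move=> [_ ext] E.
have half : 0 < (2^-1 : R) < 1 by lra.
have [] := ext (v_ i + u_ j') (v_ i' + u_ j) _ (vuP i j') (vuP i' j) half.
  rewrite (_ : 1 - 2^-1 = 2^-1 :> R); last by lra.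
  rewrite -scalerDr addrACA [u_ j' + _]addrC addrACA -E -mulr2n.
  by rewrite -scaler_nat scalerA mulVf ?scale1r // pnatr_eq0.
by move=> /addrI/u_inj-> /addIr/v_inj->.
Qed.

(* If [d <= i] and [d + j < n] the four intervals can be swapped:
   [v_ i + u_ j = v_ (d + j) + u_ (i - d)]. *)
Lemma extreme_point_vuE (i j : 'I_n) :
  extreme_point P (v_ i + u_ j) <-> ~~ [&& d <= i, d + j < n & i != d + j :> nat]%N.
Proof.
split=> [ext|].
  apply/negP => /and3P[di djn /eqP nij].
  have idn : (i - d < n)%N by have := ltn_ord i; lia.
  have E : v_ i + u_ j = v_ (Ordinal djn) + u_ (Ordinal idn).
    apply/rowP => k; rewrite !mxE -!natrD; congr _%:R => /=.
    have := ltn_ord k.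
    by case: (leqP d k); case: (ltnP k i.+1); case: (ltnP k (d + j.+1));
      case: (ltnP k (d + j).+1); case: (ltnP k (d + (i - d).+1)) => /=; lia.
  by have [/(congr1 val)/nij] := extreme_point_vu_inj ext E.
move=> H.
have [D [maxv maxu]] : exists D : nat -> nat,
    (forall l : 'I_n, l != i -> D l.+1 < D i.+1)%N /\
    (forall l : 'I_n, l != j -> D (d + l.+1) < D (d + j.+1))%N.
  have neq (k l : 'I_n) : l != k -> (l : nat) != k by [].
  have := ltn_ord i.
  move: H; rewrite !negb_and -!ltnNge negbK => /or3P[] H iltn.
  (* Here [i < d], so every right endpoint [d + l.+1] lies beyond the higher peak [i.+1]. *)
  - exists (fun k => if k == i.+1 then 2 else k == d + j.+1)%N.
    by split=> l /neq; repeat case: ifP; lia.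
  (* Here [n <= d + j], so every right endpoint [l.+1] lies before the higher peak [d + j.+1]. *)
  - exists (fun k => if k == d + j.+1 then 2 else k == i.+1)%N.
    by split=> l /neq; have := ltn_ord l; repeat case: ifP; lia.
  - exists (fun k => k == i.+1)%N.
    by split=> l /neq; lia.
(* Within each family the left endpoint is fixed, so [L] compares members by [D] at their right
   endpoints. *)
pose L := @potential R (n + d) (fun k => (D k)%:R).
apply: (exposed_extreme_point (L := L)) => l lij.
  by rewrite /v_ /= !potential_interval_row ?v_bound // ltrD2r ltr_nat maxv.
by rewrite /u_ /= !potential_interval_row ?u_bound // ltrD2r ltr_nat maxu.
Qed.

Lemma extremal_matrix_onesE (i j : 'I_n) :
  extremal_matrix R (const_mx 1%N) d i j =
  ~~ [&& d <= i, d + j < n & i != d + j :> nat]%N.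
Proof.
rewrite mxE RA_onesE pad_angle_vertex shift_angle_vertex.
by rewrite (asbool_equiv_eq (extreme_point_vuE i j)) asboolb.
Qed.

Lemma extreme_points_RA_onesE :
  [set x | extreme_point (RA R (const_mx 1%N : 'rV[nat]_n) d) x] =
  (fun p => v_ p.1 + u_ p.2) @`
    [set p : 'I_n * 'I_n | ~~ [&& d <= p.1, d + p.2 < n & p.1 != d + p.2 :> nat]%N].
Proof.
rewrite RA_onesE; apply/seteqP; split=> [x /= ext|_ [[i j] /= Hij <-]]; last first.
  exact/extreme_point_vuE.
have [[y Py [z Qz yz]] _] := ext; rewrite -yz in ext *.
have [/extreme_point_conv_hull[i vi] /extreme_point_conv_hull[j uj]] :=
  extreme_point_minkowski_sum Py Qz ext.
rewrite -vi -uj in ext *.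
by exists (i, j) => //=; apply/extreme_point_vuE.
Qed.

(** * Counting the vertices *)

Lemma card_off_diagonal m :
  #|[set q : 'I_m * 'I_m | q.1 != q.2]%SET| = (m * (m - 1))%N.
Proof.
rewrite cardsCs card_prod card_ord.
rewrite (_ : ~: _ =[set (i, i) | i in 'I_m]%SET).
  by rewrite card_imset ?card_ord ?mulnBr ?muln1 // => i i' [].
apply/setP => -[i j]; rewrite !inE negbK /=.
by apply/eqP/imsetP => [->|[k _ [-> ->]]] //; exists j.
Qed.

(** Block coordinates [(t, j)] embed injectively as [(d + t, j)], and the excluded pairs are exactly
    the images of the off-diagonal ones. *)
Lemma card_non_vertices :
  #|[set p : 'I_n * 'I_n |
      [&& d <= p.1, d + p.2 < n & p.1 != d + p.2 :> nat]%N]%SET|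
  = ((n - d) * (n - d - 1))%N.
Proof.
rewrite -card_off_diagonal.
pose f (q : 'I_(n - d) * 'I_(n - d)) := (block_row q.1, block_col q.2).
rewrite -(card_imset _ (f := f)); last first.
  by move=> [t j] [t' j'] [tt' jj']; congr pair; apply: val_inj => /=; lia.
congr #|pred_of_set _|; apply/setP => -[i j]; rewrite !inE /=.
apply/and3P/imsetP => [[di djn nij]|[[t k]]].
  have id : (i - d < n - d)%N by have := ltn_ord i; lia.
  have jd : (j < n - d)%N by lia.
  exists (Ordinal id, Ordinal jd); first by rewrite inE -val_eqE /=; lia.
  by congr pair; apply: val_inj => /=; lia.
rewrite inE -val_eqE /= => tk [-> ->] /=; have := ltn_ord k; split; lia.
Qed.

(** Uniqueness of decompositions makes the sum map injective on the admissible index pairs, so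
    counting vertices reduces to counting the complement of [Z]. *)
Lemma extreme_points_RA_ones_card :
  [set x | extreme_point (RA R (const_mx 1%N : 'rV[nat]_n) d) x] #=
  `I_(n ^ 2 - (n - d) * (n - d - 1))%N.
Proof.
pose Z := [set p : 'I_n * 'I_n |
  [&& d <= p.1, d + p.2 < n & p.1 != d + p.2 :> nat]%N]%SET.
have cardZ : #|(~: Z)%SET| = (n ^ 2 - (n - d) * (n - d - 1))%N.
  by rewrite cardsCs finset.setCK card_prod card_ord card_non_vertices.
rewrite -cardZ (card_eqr card_II) extreme_points_RA_onesE.
rewrite (card_eql (inj_card_eq _)); last first.
  move=> [i j] [i' j'] /set_mem /= Hij _ /extreme_point_vu_inj.
  by case; [exact/extreme_point_vuE | move=> -> ->].
rewrite (_ : [set p | _] = enum_val @` [set: 'I_#|(~: Z)%SET|]); last first.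
  apply/seteqP; split=> [p /= Hp|_ [k _ <-] /=].
    have pZ : p \in (~: Z)%SET by rewrite !inE.
    by exists (enum_rank_in pZ p); rewrite ?enum_rankK_in.
  by have := enum_valP k; rewrite !inE.
by apply: inj_card_eq => k k' _ _ /enum_val_inj.
Qed.

End AllOnes.

Theorem theorem51 (R : realType) (n d : nat)
    (hn : (2 <= n)%N) (hd : (1 <= d <= n - 1)%N) :
  let m := (n - d)%N in
  let a : 'rV[nat]_n := const_mx 1%N in
  let M : 'M[nat]_n := extremal_matrix R a d in
  let in_block (i j : 'I_n) : Prop :=
    let t : int := (i.+1)%:Z - d%:Z in
    (1 <= t <= m%:Z) /\ (1 <= j.+1 <= m)%N in
  [/\ forall i j : 'I_n,
        let t : int := (i.+1)%:Z - d%:Z in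
        M i j = 0%N <->
        [/\ 1 <= t <= m%:Z, (1 <= j.+1 <= m)%N & t <> (j.+1)%:Z],
      mxsub (@block_row n d) (@block_col n d) M = 1%:M :> 'M[nat]_m,
      forall i j : 'I_n, ~ in_block i j -> M i j = 1%N
    & [set x | extreme_point (RA R a d) x] #= `I_(n ^ 2 - m * (m - 1))%N].
Proof.
move=> m a M in_block; have /andP[d1 dn] := hd.
have ME (i j : 'I_n) : M i j = ~~ [&& d <= i, d + j < n & i != d + j :> nat]%N.
  exact: extremal_matrix_onesE.
split.
(* The condition [d <= i] reads [1 <= t], [d + j < n] reads [j.+1 <= m], and [t <= m] follows from
   [i < n]. *)
- move=> i j t; rewrite ME.
  have := ltn_ord i; have := ltn_ord j; rewrite /t /m => jn iltn.
  by split=> [|[]]; first split; lia.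
- apply/matrixP => t j; rewrite mxE ME mxE /=.
  (* Inside the block both inequalities hold, so only the diagonal test remains. *)
  have djn : (d + j < n)%N by have := ltn_ord j; lia.
  by rewrite leq_addr djn eqn_add2l val_eqE /= negbK; case: eqP.
- move=> i j; rewrite /in_block ME /m => nb.
  have := ltn_ord i; have := ltn_ord j; lia.
- exact: extreme_points_RA_ones_card.
Qed.
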